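(* Let $n\in\mathbb{N}$, $n\ge 2$, and let $f\in PD_n(\mathbb{R})$. Assume that $\mathrm{comp}(S_f)=2k-1$ for some $k\in\mathbb{N}$. Then $$\mathrm{card}(D_n(f))\le n^{k-1}.$$
   Context: $\mathbb{N}$ denotes the positive integers. A function $f:\mathbb{R}\to\mathbb{C}$ is positive definite if $\sum_{j,l=1}^{m} f(x_j-x_l)c_j\overline{c_l}\ge 0$ for every $m\in\mathbb{N}$, all $c_1,\dots,c_m\in\mathbb{C}$ and all $x_1,\dots,x_m\in\mathbb{R}$. $PD(\mathbb{R})$ denotes the family of continuous positive definite functions $f:\mathbb{R}\to\mathbb{C}$ that are not identically zero. For an integer $n\ge 2$, a function $f\in PD(\mathbb{R})$ is called $n$-divisible if there is $g\in PD(\mathbb{R})$ with $g^n=f$ (pointwise $n$-th power: $g(x)^n=f(x)$ for all $x\in\mathbb{R}$); $PD_n(\mathbb{R})$ denotes the family of all $n$-divisible functions in $PD(\mathbb{R})$. For $f\in PD_n(\mathbb{R})$, set $D_n(f)=\{g\in PD(\mathbb{R}): g^n=f\}$, and $\mathrm{card}(D_n(f))$ is the cardinality of this set. For $f\in PD(\mathbb{R})$, $S_f=\{x\in\mathbb{R}: f(x)\neq 0\}$ (an open subset of $\mathbb{R}$). For an open set $E\subset\mathbb{R}$, $\mathrm{comp}(E)$ denotes the number (cardinality of the family) of connected components of $E$. *)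

(* Defs.v *)
From mathcomp Require Import all_boot all_order all_algebra.
From mathcomp Require Import all_classical all_reals all_analysis.
From mathcomp Require Import complex.

Set Implicit Arguments.
Unset Strict Implicit.
Unset Printing Implicit Defensive.

Import Order.TTheory GRing.Theory Num.Theory.
Import numFieldNormedType.Exports.

Local Open Scope classical_set_scope.
Local Open Scope ring_scope.

(* In R[i], 0 <= z means that z is real and nonnegative. *)
Definition positive_definite (R : realType) (f : R -> R[i]) : Prop :=
  forall (m : nat) (c : 'I_m -> R[i]) (x : 'I_m -> R), (0 < m)%N ->
    0 <= \sum_(j < m) \sum_(l < m) f (x j - x l) * c j * (c l)^*.

(* R[i] carries no topology of its own; R[i]^o is the same type with the
   topology of the modulus. *)
Definition PD (R : realType) : set (R -> R[i]) :=
  [set f | [/\ continuous (f : R -> R[i]^o), positive_definite f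
             & exists x, f x != 0]].

Definition PD_roots (R : realType) (n : nat) (f : R -> R[i]) :
    set (R -> R[i]) :=
  [set g | PD g /\ forall x, g x ^+ n = f x].

Definition PD_divisible (R : realType) (n : nat) : set (R -> R[i]) :=
  [set f | PD f /\ exists g, PD_roots n f g].

Definition nonvanishing_set (R : realType) (f : R -> R[i]) : set R :=
  [set x | f x != 0].

Definition components (T : topologicalType) (E : set T) : set (set T) :=
  connected_component E @` E.

(* Main.v *)
Require Import Defs.
From mathcomp Require Import all_boot all_order all_algebra.
From mathcomp Require Import all_classical all_reals all_analysis.
From mathcomp Require Import complex ring lra zify.

(** Two positive definite [n]-th roots [g] and [h] of [f] differ, on a connected
    piece of the nonvanishing set [E] of [f], by a constant [n]-th root of
    unity, so they coincide on a component of [E] as soon as they agree at one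
    of its points ([PD_roots_eq], from [connected_eq_pow]).  Moreover:

    - on the component of 0 they always coincide, because [g 0] and [h 0] are
      nonnegative reals with the same [n]-th power ([pd_at0_ge0]; that 0 lies
      in [E] is [pd_at0_neq0]);
    - on a component lying in the negative reals, their values are conjugate to
      those on the opposite component ([pd_hermitian]).

    A root of [f] is therefore determined by its values at one point of each
    component lying in the positive reals.  As [x |-> - x] permutes the
    components of [E], fixing only that of 0, at most [k - 1] of the
    [2 * k - 1] components are of that kind ([half_of_components]); at each of
    the chosen points [p] there are at most [n] possible values, the roots of
    ['X^n - f p] ([closed_field_nth_roots]).  Counting the possible value
    tables gives the bound [n ^ (k - 1)] ([card_le_finfun]). *)

Set Implicit Arguments.
Unset Strict Implicit.
Unset Printing Implicit Defensive.

Import numFieldNormedType.Exports.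
Import Order.TTheory GRing.Theory Num.Theory.

Local Open Scope classical_set_scope.
Local Open Scope ring_scope.
Local Open Scope card_scope.

(** * Values of positive definite functions at 0 and at opposite points *)

Lemma pd_two_points (R : realType) (f : R -> R[i]) (x : R) (a b : R[i]) :
  positive_definite f ->
  0 <= f 0 * (a * a^*%R + b * b^*%R) + f x * a * b^*%R + f (- x) * b * a^*%R.
Proof.
move=> /(_ 2%N (fun i => if i == ord0 then a else b)
               (fun i => if i == ord0 then x else 0) isT).
rewrite !big_ord_recl !big_ord0 /= !subrr !addr0 subr0 sub0r.
by congr (0 <= _); ring.
Qed.

Lemma pd_at0_ge0 (R : realType) (f : R -> R[i]) :
  positive_definite f -> 0 <= f 0.
Proof.
move=> /(pd_two_points 0 1 0).
by rewrite rmorph1 rmorph0 !(mulr1, mulr0, mul0r, addr0).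
Qed.

(** The coefficient vectors [(1, 1)] and [(1, 'i)] at the points [x] and 0 show
    that [f x + f (- x)] and ['i * (f (- x) - f x)] are real. *)
Lemma pd_hermitian (R : realType) (f : R -> R[i]) (x : R) :
  positive_definite f -> f (- x) = (f x)^*%R.
Proof.
move=> pdf; have := pd_at0_ge0 pdf.
have := pd_two_points x 1 1 pdf; have := pd_two_points x 1 'i%C pdf.
rewrite rmorph1 !(mulr1, mul1r).
case: (f 0) (f x) (f (- x)) => [a b] [p q] [p' q'].
rewrite !lecE /=; simpc.
move=> /andP[/eqP re _] /andP[/eqP im _] /andP[/eqP b0 _].
by congr (_ +i* _)%C; lra.
Qed.

(** If [f 0 = 0], the coefficients [1] and [- f x] turn positivity at the points
    [x] and 0 into [0 <= - 2 * |f x| ^ 2]. *)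
Lemma pd_at0_neq0 (R : realType) (f : R -> R[i]) (x : R) :
  positive_definite f -> f x != 0 -> f 0 != 0.
Proof.
move=> pdf; apply: contra_neq => f0.
have := pd_two_points x 1 (- f x) pdf.
rewrite f0 mul0r add0r pd_hermitian // rmorph1 rmorphN.
have -> : f x * 1 * - (f x)^*%R + (f x)^*%R * - f x * 1
    = - (`|f x| ^+ 2 *+ 2) by rewrite normCK; ring.
rewrite oppr_ge0 pmulrn_lle0 // => fx.
by apply/eqP; rewrite -normr_eq0 -sqrf_eq0 eq_le fx exprn_ge0.
Qed.

(** * Roots on a connected set and on components *)

(** Write [g ^ n - h ^ n = (g - h) * q].  Where [g = h], the cofactor [q] equals
    [n * h ^ (n - 1)], which does not vanish; so on [B] the sets where [g = h]
    and where [q <> 0] coincide, and this set is both closed and open in [B]. *)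
Lemma connected_eq_pow (T : topologicalType) (K : numFieldType) (n : nat)
    (g h : T -> K) (B : set T) (x y : T) :
  (0 < n)%N -> continuous g -> continuous h -> connected B ->
  (forall z, B z -> g z ^+ n = h z ^+ n) -> (forall z, B z -> h z != 0) ->
  B x -> B y -> g x = h x -> g y = h y.
Proof.
move=> n0 cg ch cB gh h0 Bx By gx.
pose q z := \sum_(i < n) g z ^+ (n.-1 - i) * h z ^+ i.
have cX (u : T -> K) k : continuous u -> continuous (fun z => u z ^+ k).
  move=> cu z; elim: k => [|k ih].
    by under eq_fun do rewrite expr0; exact: cst_continuous.
  by under eq_fun do rewrite exprS; exact: continuousM (cu z) ih.
have cq : continuous q.
  rewrite /q; elim: (index_enum _) => [|i s ih] z.
    by under eq_fun do rewrite big_nil; exact: cst_continuous.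
  under eq_fun do rewrite big_cons.
  by apply: continuousD (ih z); apply: continuousM; exact: cX.
have clK : closed [set (0 : K)].
  exact/accessible_closed_set1/hausdorff_accessible/norm_hausdorff.
have qE z : B z -> (g z = h z) <-> (q z <> 0).
  move=> Bz; split=> [gz|/eqP qz].
    apply/eqP.
    rewrite /q gz (eq_bigr (fun=> h z ^+ n.-1)) => [|i _].
      by rewrite sumr_const card_ord mulrn_eq0 negb_or -lt0n n0 expf_neq0 ?h0.
    by rewrite -exprD subnK // -ltnS prednK.
  apply/eqP; rewrite -subr_eq0; have /eqP := subrXX (g z) (h z) n.
  by rewrite gh // subrr eq_sym mulf_eq0 (negPf qz) orbF.
suff qB : B `&` [set z | q z <> 0] = B.
  by have [_ /(qE _ By)] : (B `&` [set z | q z <> 0]) y by rewrite qB.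
apply: cB.
- by exists x; split => //=; apply/qE.
- exists [set z | q z <> 0] => //.
  by move/continuousP: cq => /(_ _ (closed_openC clK)).
- exists [set z | g z - h z = 0].
    have : continuous (fun z => g z - h z).
      by move=> z; apply: continuousB; [exact: cg|exact: ch].
    by move=> /continuous_closedP/(_ _ clK).
  apply/seteqP; split => z [Bz] /=.
    by move=> /(qE _ Bz) ->; rewrite subrr.
  by move=> /subr0_eq/(qE _ Bz).
Qed.

Lemma PD_roots_eq (R : realType) (n : nat) (f g h : R -> R[i]) (x y : R) :
  (0 < n)%N -> PD_roots n f g -> PD_roots n f h ->
  connected_component (nonvanishing_set f) x y -> g x = h x -> g y = h y.
Proof.
move=> n0 [[cg _ _] gf] [[ch _ _] hf] xy.
have Cf := @connected_component_sub _ (nonvanishing_set f) x.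
apply: (@connected_eq_pow R R[i] n g h _ x y n0 cg ch
  (@component_connected _ _ x)) => //.
- by move=> z _; rewrite gf hf.
- move=> z /Cf; rewrite /nonvanishing_set /= -hf.
  by rewrite expf_eq0 n0.
- exact/connected_component_refl/(connected_component_sub
    (connected_component_sym xy)).
- exact: xy.
Qed.

(** * Components of a symmetric subset of the line *)

Lemma connected_component_opp (R : realType) (E : set R) (x y : R) :
  (forall z, E z -> E (- z)) ->
  connected_component E x y -> connected_component E (- x) (- y).
Proof.
move=> symE [C [Cx CE cC] Cy]; exists (-%R @` C); last by exists y.
split; first by exists x.
  by move=> _ [z Cz <-]; exact/symE/CE.
by apply: connected_continuous_connected => //;
  apply: continuous_subspaceT; exact: oppr_continuous.
Qed.

Lemma connected_component_between (R : realType) (E : set R) (x y z : R) :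
  connected_component E x y -> x <= z <= y -> connected_component E x z.
Proof.
move=> xy xzy.
have /connected_intervalP := @component_connected _ E x.
by apply; [apply: connected_component_refl|exact: xy|exact: xzy];
  exact: connected_component_sub (connected_component_sym xy).
Qed.

(** The points [p i] represent the components lying in the positive reals: a
    component other than that of 0 is an interval missing 0, so it or its
    opposite is among them, but not both.  Hence they, their opposites and the
    component of 0 are [2 * #|I| + 1] different components. *)
Lemma half_of_components (R : realType) (E : set R) (k : nat) :
  E 0 -> (forall z, E z -> E (- z)) -> components E #= `I_(2 * k - 1) ->
  exists (I : finType) (p : I -> R), (#|I| <= k - 1)%N /\
    forall x, E x -> [\/ connected_component E 0 x,
      exists i, connected_component E (p i) x
    | exists i, connected_component E (p i) (- x)].
Proof.
move=> E0 symE /card_esym/card_set_bijP[c [cE cinj csurj]].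
set N := (2 * k - 1)%N in cE cinj csurj.
have /choice[y yP] (i : 'I_N) : exists x, E x /\ connected_component E x = c i.
  by have [x Ex cx] := cE i (ltn_ord i); exists x.
have cover x : E x -> exists i, connected_component E (y i) x.
  move=> Ex; have [i iN ci] := csurj _ (imageP (connected_component E) Ex).
  exists (Ordinal iN); have [_ ->] := yP (Ordinal iN).
  by rewrite ci; exact: connected_component_refl.
have y_inj i j : connected_component E (y i) (y j) -> i = j.
  move=> /same_connected_component; have [_ ->] := yP i; have [_ ->] := yP j.
  by move=> cij; apply/val_inj/cinj => //; apply/mem_set/ltn_ord.
have opp0 x : connected_component E 0 (- x) -> connected_component E 0 x.
  by move=> /(connected_component_opp symE); rewrite oppr0 opprK.
have [i0 yi0] := cover _ E0.
(* [sg] is the action of [x |-> - x] on the indices of the components. *)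
have /choice[sg sgP] i : exists j, connected_component E (y j) (- y i).
  by have [Ey _] := yP i; exact/cover/symE.
have sg_off0 i : connected_component E (y (sg i)) 0 ->
    connected_component E 0 (y i).
  move=> /connected_component_sym s0; apply: opp0.
  exact: connected_component_trans s0 (sgP i).
pose A := [set i | (0 < y i) && ~~ `[< connected_component E 0 (y i) >]]%SET.
have inA i : i \in A -> 0 < y i /\ ~ connected_component E 0 (y i).
  by rewrite inE => /andP[? /asboolPn].
exists {i | i \in A}, (y \o val); split => [|x Ex]; last first.
- have [j yjx] := cover _ Ex.
  have [y0|y0] := pselect (connected_component E 0 (y j)).
    by constructor 1; exact: connected_component_trans y0 yjx.
  have [yj|yj|yj] := ltgtP (y j) 0.
  + suff sA : sg j \in A.
      constructor 3; exists (Sub (sg j) sA) => /=.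
      apply: connected_component_trans (sgP j) _.
      exact: connected_component_opp.
    rewrite inE; apply/andP; split.
      rewrite ltNge; apply/negP => sg0; apply/y0/sg_off0.
      by apply: connected_component_between (sgP j) _; rewrite sg0 oppr_ge0 ltW.
    apply/asboolPn => s0; apply/y0/sg_off0; exact: connected_component_sym.
  + have jA : j \in A by rewrite inE yj; apply/asboolPn.
    by constructor 2; exists (Sub j jA).
  + by exfalso; apply: y0; rewrite yj; exact: connected_component_refl.
- rewrite card_sig (_ : #|_| = #|A|); last exact: eq_card.
  have sg_inj : {in A &, injective sg}.
    move=> i j _ _ sij; apply: y_inj.
    rewrite -[y i]opprK -[y j]opprK; apply: connected_component_opp => //.
    apply: connected_component_trans (sgP j).
    by rewrite -sij; apply: connected_component_sym.
  have dis : (A :&: sg @: A = finset.set0)%SET.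
    apply/finset.setP => j; rewrite finset.in_setI finset.in_set0.
    apply/negP => /andP[/inA[yj _] /imsetP[i /inA[yi ni0] sij]].
    apply/ni0/opp0/connected_component_sym.
    apply: connected_component_between (connected_component_sym (sgP i)) _.
    by rewrite -sij oppr_le0 !ltW.
  have i0N : i0 \notin (A :|: sg @: A)%SET.
    rewrite finset.in_setU; apply/norP; split; apply/negP.
      by move=> /inA[_]; apply; exact: connected_component_sym.
    move=> /imsetP[i /inA[_ ni0] si0].
    by apply/ni0/sg_off0; rewrite -si0.
  have := max_card (mem (i0 |: (A :|: sg @: A))%SET).
  rewrite cardsU1 i0N cardsU dis cards0 subn0 card_in_imset // card_ord.
  by rewrite /N add1n; lia.
Qed.

(** * Counting the roots of a positive definite function *)

Lemma closed_field_nth_roots (K : closedFieldType) (n : nat) (a : K) :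
  (0 < n)%N ->
  exists2 s : seq K, (size s <= n)%N & forall z, z ^+ n = a -> z \in s.
Proof.
move=> n0; have [s Es] := closed_field_poly_normal ('X^n - a%:P).
have pm : 'X^n - a%:P \is monic by exact: monicXnsubC.
move: Es; rewrite (monicP pm) scale1r => Es.
exists s => [|z za].
  by rewrite -ltnS -(size_prod_XsubC s id) -Es size_XnsubC.
by rewrite -root_prod_XsubC -Es rootE !hornerE za subrr.
Qed.

Lemma card_le_finfun (T : Type) (A : set T) (I : finType) (n : nat)
    (phi : T -> I -> nat) :
  (0 < n)%N -> (forall x i, A x -> (phi x i < n)%N) ->
  (forall x y, A x -> A y -> phi x =1 phi y -> x = y) ->
  A #<= `I_(n ^ #|I|).
Proof.
case: n => // n _ phin phi_inj.
pose F x := [ffun i => inord (phi x i) : 'I_n.+1].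
apply/pcard_leP/injfunPex; exists (fun x => enum_rank (F x) : nat).
  move=> x _ /=; apply: leq_trans (ltn_ord _) _.
  by rewrite card_ffun card_ord.
move=> x y /set_mem Ax /set_mem Ay /val_inj/enum_rank_inj/ffunP FE.
apply: phi_inj => // i.
by have := congr1 (@nat_of_ord _) (FE i); rewrite !ffunE !inordK ?phin.
Qed.

Theorem theorem1 (R : realType) (n k : nat) (f : R -> R[i])
    (hn : (2 <= n)%N) (hk : (1 <= k)%N) (hf : PD_divisible n f)
    (hcomp : components (nonvanishing_set f) #= `I_(2 * k - 1)) :
  PD_roots n f #<= `I_(n ^ (k - 1)).
Proof.
have n0 : (0 < n)%N by exact: ltnW.
have [[_ pdf [x0 fx0]] _] := hf.
set E := nonvanishing_set f in hcomp.
have E0 : E 0 by exact: pd_at0_neq0 fx0.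
have symE z : E z -> E (- z).
  by rewrite /E /nonvanishing_set /= pd_hermitian // conjC_eq0.
have [I [p [cI covE]]] := half_of_components E0 symE hcomp.
have /choice[s sP] (i : I) : exists s : seq R[i],
    (size s <= n)%N /\ forall z, z ^+ n = f (p i) -> z \in s.
  by have [s] := closed_field_nth_roots (f (p i)) n0; exists s.
have gs g i : PD_roots n f g -> g (p i) \in s i.
  by move=> [_ gf]; apply: (sP i).2.
suff : PD_roots n f #<= `I_(n ^ #|I|).
  move=> /card_le_trans; apply; rewrite card_le_II.
  by rewrite leq_exp2l.
(* A root [g] is encoded by the positions of its values [g (p i)] in [s i]. *)
apply: (@card_le_finfun _ _ I n (fun g i => index (g (p i)) (s i))) => //.
  move=> g i Dg; apply: leq_trans (sP i).1.
  by rewrite index_mem gs.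
move=> g h Dg Dh gh.
have [[_ pdg _] gf] := Dg; have [[_ pdh _] hf'] := Dh.
have ghp i : g (p i) = h (p i).
  by rewrite -(nth_index 0 (gs _ i Dg)) gh nth_index ?gs.
apply/funext => x.
have [Ex|Ex] := pselect (E x); last first.
  have fx : f x = 0 by apply/eqP; apply: contra_notT Ex.
  have z0 (u : R[i]) : u ^+ n = f x -> u = 0.
    by rewrite fx => /eqP; rewrite expf_eq0 n0 => /eqP.
  by rewrite (z0 _ (gf x)) (z0 _ (hf' x)).
case: (covE _ Ex) => [c0|[i ci]|[i ci]].
- apply: (PD_roots_eq n0 Dg Dh c0).
  apply: (pexpIrn n0); rewrite ?nnegrE ?pd_at0_ge0 //.
  by rewrite gf hf'.
- exact: PD_roots_eq n0 Dg Dh ci (ghp i).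
- have := PD_roots_eq n0 Dg Dh ci (ghp i).
  by rewrite !pd_hermitian // => /(can_inj (@conjCK _)).
Qed.
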